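(* The map $$\mathsf{P}(\mathbb{R})\longrightarrow\mathbb{R},\qquad \mu\longmapsto\int\cos\,d\mu,$$ is not sample-smooth, although $\cos:\mathbb{R}\to\mathbb{R}$ is sample-smooth, bounded, and has all derivatives bounded. Consequently the two-variable evaluation $(h,\mu)\mapsto\int h\,d\mu$ is not sample-smooth as a map $\mathcal{C}_b(\mathbb{R})\times\mathsf{P}(\mathbb{R})\to\mathbb{R}$, where $\mathcal{C}_b(\mathbb{R})\subseteq\mathbb{R}^{\mathbb{R}}$ is the subobject of bounded sample-smooth functions.
   Context: **Sample space.** $\Omega=[0,1]^{\mathbb{N}}$; $\mathcal{B}_\Omega$ is the universal completion of its Borel (product) $\sigma$-algebra, i.e. all universally measurable subsets; $\Omega^\Omega$ is the set of all $\mathcal{B}_\Omega$-$\mathcal{B}_\Omega$-measurable self-maps of $\Omega$; $\mathsf{P}_\Omega$ is the set of all probability measures on $\mathcal{B}_\Omega$; $U=\bigotimes_{n}U[0,1]$ is the uniform measure. $\Theta=(\Theta_1,\Theta_2):\Omega\to\Omega\times\Omega$ is the Borel isomorphism de-interleaving the coordinates of a sequence (e.g. even- and odd-indexed coordinates); $\Theta_*U=U\otimes U$. **Site.** $\Omega_n:=\mathbb{R}^n\times\Omega$, $n\ge0$ ($\Omega_0=\Omega$). A map $g:\Omega_m\to\mathbb{R}^n$ is mixed-smooth, $g\in\mathcal{C}^\infty_{\mathrm{mix}}(\Omega_m,\mathbb{R}^n)$, if (M1) $g(-,\omega)\in C^\infty(\mathbb{R}^m,\mathbb{R}^n)$ for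 every $\omega$, and (M2) $g(t,-)$ is $\mathcal{B}_\Omega$-Borel measurable for every $t$. The category $\mathbb{S}$ has objects $\Omega_n$ and morphisms $\mathbb{S}(\Omega_m,\Omega_n)=\{(g,\Phi): g\in\mathcal{C}^\infty_{\mathrm{mix}}(\Omega_m,\mathbb{R}^n),\Phi\in\Omega^\Omega\}$, where $(g,\Phi)(t,\omega)=(g(t,\omega),\Phi(\omega))$. **Sample-smooth spaces.** A sample-smooth space is a set $\mathcal{X}$ with, for each $n\ge0$, a set $\mathcal{X}^{\Omega_n}$ of maps $\Omega_n\to\mathcal{X}$ (plots) containing all constant maps and such that $p\in\mathcal{X}^{\Omega_n}$, $h\in\mathbb{S}(\Omega_m,\Omega_n)$ imply $p\circ h\in\mathcal{X}^{\Omega_m}$. A map $f:\mathcal{X}\to\mathcal{Y}$ is sample-smooth (a morphism of $\mathbf{SSS}$) if $f\circ p\in\mathcal{Y}^{\Omega_n}$ for all $n$ and $p\in\mathcal{X}^{\Omega_n}$. Write $\mathcal{X}^\Omega:=\mathcal{X}^{\Omega_0}$. Products: $(\prod_i\mathcal{X}_i)^{\Omega_n}=\prod_i\mathcal{X}_i^{\Omega_n}$. $\mathbb{R}^k$ carries the plots $\mathcal{C}^\infty_{\mathrm{mix}}(\Omega_n,\mathbb{R}^k)$. The induced $\sigma$-algebra is $\mathcal{B}_{\mathcal{X}}:=\{A\subseteq\mathcal{X}: X^{-1}(A)\in\mathcal{B}_\Omega\ \forall X\in\mathcal{X}^\Omega\}$. A subset $\mathcal{A}\subseteq\mathcal{X}$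 as a subobject carries the plots of $\mathcal{X}$ with values in $\mathcal{A}$. The function space $\mathcal{Y}^{\mathcal{X}}$ is $\mathbf{SSS}(\mathcal{X},\mathcal{Y})$ with plots those $F:\Omega_n\to\mathcal{Y}^{\mathcal{X}}$ such that for all $m$, $h\in\mathbb{S}(\Omega_m,\Omega_n)$, $q\in\mathcal{X}^{\Omega_m}$ one has $(u\mapsto F(h(u))(q(u)))\in\mathcal{Y}^{\Omega_m}$. **Space of measures.** $\mathsf{P}(\mathcal{X}):=\{X_*P: X\in\mathcal{X}^\Omega, P\in\mathsf{P}_\Omega\}$, a set of probability measures on $(\mathcal{X},\mathcal{B}_{\mathcal{X}})$, with plots $\mathsf{P}(\mathcal{X})^{\Omega_n}:=\{\mathsf{L}Y: Y\in\mathcal{X}^{\Omega_n}\}$, $\mathsf{L}Y(t,\omega):=(\omega'\mapsto Y(t,\Theta^{-1}(\omega,\omega')))_*U$. *)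

(* Defs.v *)
From HB Require Import structures.
From mathcomp Require Import all_boot all_order all_algebra.
From mathcomp Require Import all_classical all_reals all_analysis.
From mathcomp Require Import measurable_realfun.

Set Implicit Arguments.
Unset Strict Implicit.
Unset Printing Implicit Defensive.

Import Order.TTheory GRing.Theory Num.Theory.
Import numFieldNormedType.Exports.

Local Open Scope classical_set_scope.
Local Open Scope ring_scope.

(** * The sample space *)

Definition Omega (R : realType) : Type := nat -> {i01 R}.

Section Omega_pointed.
Variable R : realType.

HB.instance Definition _ := gen_eqMixin (Omega R).
HB.instance Definition _ := gen_choiceMixin (Omega R).
HB.instance Definition _ := isPointed.Build (Omega R) (fun=> 0%:i01).

End Omega_pointed.

Definition cylinders (R : realType) : set (set (Omega R)) :=
  [set C | exists n (A : set R), measurable A /\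
     C = [set w : Omega R | A (w n)%:num]].

(* [Omega R] with its Borel (product) sigma-algebra; [Omega R] itself is given
   the universal completion of the latter below. *)
Definition borel_Omega (R : realType) := g_sigma_algebraType (@cylinders R).

(* For a measure mu, [completed_algebra_gen mu] is the set of all A `|` N with A
   measurable and N mu-negligible, i.e. the domain of the completion of mu. *)
Definition universally_measurable (R : realType) : set (set (Omega R)) :=
  [set A | forall mu : probability (borel_Omega R) R,
     completed_algebra_gen mu A].

Section universal_completion.
Variable R : realType.
Local Notation UM := (@universally_measurable R).

Lemma universally_measurable0 : UM set0.
Proof.
move=> mu; exists set0; first exact: measurable0.
by exists set0; [exact: negligible_set0 | rewrite setU0].
Qed.

Lemma universally_measurableC A : UM A -> UM (~` A).
Proof.
move=> UA mu; have [B /= mB [N [M [mM M0 NM]] BNA]] := UA mu.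
exists (~` B `\` M); first by apply: measurableD => //; exact: measurableC.
exists (M `&` ~` A); first by exists M; split => // x [].
rewrite -BNA; apply/seteqP; split => x /=.
  by case=> [[nB nM] [//|/NM//]|[_]].
move=> nBN; have [Mx|nMx] := pselect (M x); first by right.
by left; split=> // Bx; apply: nBN; left.
Qed.

Lemma universally_measurable_bigcup (F : (set (Omega R))^nat) :
  (forall i, UM (F i)) -> UM (\bigcup_i F i).
Proof.
move=> UF mu.
have /choice[B HB] : forall i, exists B : set (borel_Omega R), measurable B /\
    exists2 N, mu.-negligible N & B `|` N = F i.
  by move=> i; have [B mB BF] := UF i mu; exists B; split.
have /choice[N HN] : forall i, exists N, mu.-negligible N /\ B i `|` N = F i.
  by move=> i; have [_ [N nN BN]] := HB i; exists N; split.
exists (\bigcup_i B i).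
  by apply: bigcupT_measurable => i; exact: (HB i).1.
exists (\bigcup_i N i).
  by apply: negligible_bigcup => i; exact: (HN i).1.
by rewrite -bigcupU; apply: eq_bigcupr => i _; exact: (HN i).2.
Qed.

Definition Omega_display : measure_display.
Proof. exact. Qed.

HB.instance Definition _ := @isMeasurable.Build Omega_display (Omega R) UM
  universally_measurable0 universally_measurableC universally_measurable_bigcup.

End universal_completion.

(* The coordinates are i.i.d. uniform on [0, 1]. The values on these sets
   determine a probability measure on the universally measurable sets. *)
Definition uniform_measure (R : realType) (U : probability (Omega R) R) : Prop :=
  forall (n : nat) (A : nat -> set R), (forall i, measurable (A i)) ->
    U [set w | forall i, (i < n)%N -> A i (w i)%:num] =
    (\prod_(i < n) uniform_prob (@ltr01 R) (A i))%E.

(* The isomorphism Theta separates even- and odd-indexed coordinates. *)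
Definition Theta (R : realType) (w : Omega R) : Omega R * Omega R :=
  (fun n => w n.*2, fun n => w n.*2.+1).

Definition Theta_inv (R : realType) (w w' : Omega R) : Omega R :=
  fun n => if odd n then w' n./2 else w n./2.

Lemma ThetaK (R : realType) (w : Omega R) :
  Theta_inv (Theta w).1 (Theta w).2 = w.
Proof.
apply/funext => n; rewrite /Theta_inv /=.
by case: ifP => on; rewrite -[in RHS](odd_double_half n) on.
Qed.

Lemma Theta_invK (R : realType) (w w' : Omega R) : Theta (Theta_inv w w') = (w, w').
Proof.
congr pair; apply/funext => n; rewrite /Theta_inv /= odd_double /=.
  by rewrite doubleK.
by rewrite uphalf_double.
Qed.

(** * The site *)

Definition Omega_ (R : realType) (n : nat) : Type := ('rV[R]_n * Omega R)%type.

Fixpoint Ck (R : realType) (m : nat) (V : normedModType R) (k : nat)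
    (f : 'rV[R]_m -> V) : Prop :=
  continuous f /\
  if k is k'.+1 then
    forall i : 'I_m, let e : 'rV[R]_m := delta_mx 0 i in
      (forall x, derivable f x e) /\ Ck k' ('D_e f)
  else True.

Definition Cinfty (R : realType) (m : nat) (V : normedModType R)
    (f : 'rV[R]_m -> V) : Prop := forall k, Ck k f.

(* [<<s open >>] is the Borel sigma-algebra of [V]. *)
Definition Cmix (R : realType) (V : normedModType R) (m : nat) :
    set (Omega_ R m -> V) :=
  [set g | (forall w, Cinfty (fun t => g (t, w))) /\
     (forall t (A : set V), <<s open >> A ->
        measurable [set w : Omega R | A (g (t, w))])].

Definition site_hom (R : realType) (m n : nat) : set (Omega_ R m -> Omega_ R n) :=
  [set h | exists (g : Omega_ R m -> 'rV[R]_n) (Phi : Omega R -> Omega R),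
     [/\ Cmix g, measurable_fun [set: Omega R] Phi &
      h = fun u => (g u, Phi u.2)]].

(** * Sample-smooth spaces *)

(* Candidate plots Omega_n -> T for each n. *)
Definition plot_family (R : realType) (T : Type) : Type :=
  forall n : nat, set (Omega_ R n -> T).

Definition sample_smooth_space (R : realType) (T : Type)
    (p : plot_family R T) : Prop :=
  (forall n (x : T), p n (fun=> x)) /\
  (forall m n (q : Omega_ R n -> T) (h : Omega_ R m -> Omega_ R n),
     p n q -> site_hom h -> p m (q \o h)).

(* Being sample-smooth depends on the plots only, so the axioms
   [sample_smooth_space] are not bundled with them. *)
Definition sample_smooth (R : realType) (S T : Type)
    (pS : plot_family R S) (pT : plot_family R T) (f : S -> T) : Prop :=
  forall n p, pS n p -> pT n (f \o p).

(* The plots on [Omega = Omega_0], seen as maps on [Omega R]. *)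
Definition Omega_plot (R : realType) (T : Type) (p : plot_family R T) :
    set (Omega R -> T) :=
  [set X | p 0 (fun u => X u.2)].

Definition normed_plots (R : realType) (V : normedModType R) : plot_family R V :=
  @Cmix R V.
Arguments normed_plots R V n _ : clear implicits.

Definition real_plots (R : realType) : plot_family R R := normed_plots R R^o.
Arguments real_plots R n _ : clear implicits.

Definition prod_plots (R : realType) (S T : Type)
    (pS : plot_family R S) (pT : plot_family R T) : plot_family R (S * T) :=
  fun n => [set p | pS n (fst \o p) /\ pT n (snd \o p)].
Arguments prod_plots {R S T} pS pT n _.

Definition sub_plots (R : realType) (T : Type) (pT : plot_family R T)
    (A : set T) : plot_family R {x : T | A x} :=
  fun n => [set p | pT n (fun u => sval (p u))].
Arguments sub_plots {R T} pT A n _.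

Definition fun_space (R : realType) (S T : Type)
    (pS : plot_family R S) (pT : plot_family R T) : Type :=
  {f : S -> T | sample_smooth pS pT f}.

Definition fun_plots (R : realType) (S T : Type)
    (pS : plot_family R S) (pT : plot_family R T) :
    plot_family R (fun_space pS pT) :=
  fun n => [set F | forall m (h : Omega_ R m -> Omega_ R n) (q : Omega_ R m -> S),
     site_hom h -> pS m q -> pT m (fun u => sval (F (h u)) (q u))].
Arguments fun_plots {R S T} pS pT n _.

Definition bounded_real (R : realType) :
    set (fun_space (real_plots R) (real_plots R)) :=
  [set f | exists M : R, forall x, `|sval f x| <= M].
Arguments bounded_real R _ : clear implicits.

Definition Cb (R : realType) : Type := {f | bounded_real R f}.

Definition Cb_plots (R : realType) : plot_family R (Cb R) :=
  sub_plots (fun_plots (real_plots R) (real_plots R)) (bounded_real R).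
Arguments Cb_plots R n _ : clear implicits.

(** * Induced sigma-algebras and spaces of measures *)

(* An alias of [T] carrying the sigma-algebra induced by the plots [p]; [T] is
   pointed because every [measurableType] is. *)
Definition induced_space (R : realType) (T : pointedType) (p : plot_family R T) : Type :=
  T.

Definition induced_measurable (R : realType) (T : pointedType)
    (p : plot_family R T) : set (set (induced_space p)) :=
  [set A | forall X, Omega_plot p X -> measurable (X @^-1` A)].

Section induced_sigma_algebra.
Variables (R : realType) (T : pointedType) (p : plot_family R T).

Lemma induced_measurable0 : induced_measurable (p := p) set0.
Proof. by move=> X _; rewrite preimage_set0; exact: measurable0. Qed.

Lemma induced_measurableC (A : set (induced_space p)) :
  induced_measurable A -> induced_measurable (~` A).
Proof. by move=> mA X pX; rewrite preimage_setC; exact/measurableC/mA. Qed.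

Lemma induced_measurable_bigcup (F : (set (induced_space p))^nat) :
  (forall i, induced_measurable (F i)) -> induced_measurable (\bigcup_i F i).
Proof.
move=> mF X pX; rewrite preimage_bigcup.
by apply: bigcupT_measurable => i; exact: mF.
Qed.

Definition induced_display : measure_display.
Proof. exact. Qed.

HB.instance Definition _ := Pointed.copy (induced_space p) T.
HB.instance Definition _ := @isMeasurable.Build induced_display (induced_space p)
  (@induced_measurable R T p) induced_measurable0 induced_measurableC
  induced_measurable_bigcup.

End induced_sigma_algebra.

(* A [probability] is a function on all sets, of which only the restriction to
   the measurable ones is meaningful, so equality of measures is always taken on
   measurable sets; the plots below are closed under this equality. *)
Definition measures (R : realType) (T : pointedType) (p : plot_family R T) : Type :=
  {mu : probability (induced_space p) R |
    exists (X : Omega R -> T) (P : probability (Omega R) R),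
      Omega_plot p X /\
      forall A : set (induced_space p), measurable A -> mu A = P (X @^-1` A)}.

Definition measure_of (R : realType) (T : pointedType) (p : plot_family R T)
    (mu : measures p) : probability (induced_space p) R := sval mu.

(* [F] is a plot when it is L Y for a plot [Y]. *)
Definition measures_plots (R : realType) (U : probability (Omega R) R)
    (T : pointedType) (p : plot_family R T) : plot_family R (measures p) :=
  fun n => [set F | exists2 Y : Omega_ R n -> T, p n Y &
    forall t w (A : set (induced_space p)), measurable A ->
      measure_of (F (t, w)) A = U [set w' | A (Y (t, Theta_inv w w'))]].
Arguments measures_plots {R} U {T} p n _.

(* Main.v *)
Require Import Defs.
From HB Require Import structures.
From mathcomp Require Import all_boot all_order all_algebra.
From mathcomp Require Import all_classical all_reals all_analysis.
From mathcomp Require Import measurable_realfun lra.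

Set Implicit Arguments.
Unset Strict Implicit.
Unset Printing Implicit Defensive.

Import Order.TTheory GRing.Theory Num.Theory.
Import numFieldNormedType.Exports.

Local Open Scope classical_set_scope.
Local Open Scope ring_scope.

(** Fix a coordinate, uniform on [0, 1], of the randomness that L integrates
    out, and let mu_t be the law of t / w, where w is that coordinate. Then
    (t, v) |-> mu_t is a plot of the space of measures: it is L Y for
    Y (t, v) = t / v_1, which is linear in t, and the coordinate 1 of v is the
    coordinate 0 of the second half of v under Theta. The integral of cos
    against mu_t is phi t = E cos (t / w), the real part of the characteristic
    function of 1 / w, which has heavy tails. As w falls in [|t| / pi, 2 |t| /
    pi] with probability |t| / pi, and the cosine is nonpositive there, phi t <=
    1 - |t| / pi for small t <> 0 ([reciprocal_char_le]), while phi 0 = 1. So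
    phi has a corner at 0, where it cannot be differentiable
    ([corner_not_derivable]), and phi is not a plot of the real line:
    integration of cos does not preserve plots. Boundedness of cos and of its
    derivatives does not help, because t enters through t / w, whose derivative
    in t is not integrable.

    The same plot, paired with the constant plot at cos, defeats the two-variable
    evaluation. That cos is a point of the function space, and its constant family
    a plot, is the sample-smoothness of cos, which is the chain rule: composition
    with cos and sin preserves the class C^k, by a simultaneous induction on k
    ([Ck_cos_sin]). *)

(** * Measurability on the real line and on the sample space *)

(** Mixed smoothness refers to the sigma-algebra generated by the open sets,
    while [measurable] on the line is generated by half-open intervals. *)
Lemma borel_realE (R : realType) : <<s (open : set (set R^o)) >> = @measurable _ R.
Proof.
apply/seteqP; split.
  apply: smallest_sub => [|A oA]; last exact: open_measurable.
  exact: sigma_algebra_measurable.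
rewrite [X in X `<=` _]RGenOpens.measurableE.
apply: sub_sigma_algebra2 => A [x [y ->]]; exact: interval_open.
Qed.

Lemma measurable_realP (R : realType) (f : Omega R -> R) :
  (forall A : set R^o, <<s open >> A -> measurable (f @^-1` A)) <->
  measurable_fun [set: Omega R] f.
Proof.
split=> [h _ A mA|mf A]; rewrite ?setTI.
  by apply: h; rewrite borel_realE.
by rewrite borel_realE => mA; rewrite -[X in measurable X]setTI; exact: mf.
Qed.

Lemma measurable_cos (R : realType) : measurable_fun [set: R] (@cos R).
Proof. by apply: continuous_measurable_fun; exact: continuous_cos. Qed.

Lemma borel_universally_measurable (R : realType) (A : set (borel_Omega R)) :
  measurable A -> measurable (A : set (Omega R)).
Proof.
rewrite /measurable /= => mA mu; exists A => //.
exists set0; first exact: negligible_set0.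
by rewrite setU0.
Qed.

Lemma measurable_coord (R : realType) (n : nat) :
  measurable_fun [set: Omega R] (fun w => (w n)%:num).
Proof.
move=> _ A mA; rewrite setTI; apply: borel_universally_measurable.
by apply: sub_sigma_algebra; exists n, A.
Qed.

Lemma measurable_invcoord (R : realType) (n : nat) :
  measurable_fun [set: Omega R] (fun w => (w n)%:num^-1).
Proof.
(* Coordinates are nonnegative, and there the inverse is the power -1, also at
   0, where both are 0. *)
have -> : (fun w : Omega R => (w n)%:num^-1) =
          (@powR R ^~ (-1)) \o (fun w => (w n)%:num).
  by apply/funext => w /=; rewrite powR_inv1.
apply: measurableT_comp; [exact: measurable_powR | exact: measurable_coord].
Qed.

(** * Smooth functions, the cosine and corners *)

Section Ck_calculus.
Variables (R : realType) (m : nat).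
Implicit Types (f g : 'rV[R]_m -> R^o) (k : nat).

Lemma CkS k f : Ck k.+1 f -> Ck k f.
Proof.
elim: k f => [|k IH] f [cf df]; split=> // i.
by have [? ?] := df i; split=> //; exact: IH.
Qed.

Lemma Ck_cst k (c : R) : Ck k (fun _ : 'rV[R]_m => c : R^o).
Proof.
elim: k c => [|k IH] c; (split; first by move=> x; exact: cst_continuous) => // i.
split; first by move=> x; exact: derivable_cst.
rewrite (_ : 'D__ _ = fun=> 0 : R^o); first exact: IH.
by apply/funext => x; exact: derive_cst.
Qed.

Lemma CkD k f g : Ck k f -> Ck k g -> Ck k (fun x => f x + g x : R^o).
Proof.
elim: k f g => [|k IH] f g [cf df] [cg dg];
  (split; first by move=> x; apply: continuousD; [exact: cf|exact: cg]) => // i.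
have [{}df Df] := df i; have [{}dg Dg] := dg i.
split; first by move=> x; exact: derivableD.
rewrite (_ : 'D__ _ = fun x => 'D_(delta_mx 0 i) f x + 'D_(delta_mx 0 i) g x).
  exact: IH.
by apply/funext => x; exact: deriveD.
Qed.

Lemma CkM k f g : Ck k f -> Ck k g -> Ck k (fun x => f x * g x : R^o).
Proof.
elim: k f g => [|k IH] f g Cf Cg; have [cf df] := Cf; have [cg dg] := Cg;
  (split; first by move=> x; apply: continuousM; [exact: cf|exact: cg]) => // i.
have [{}df Df] := df i; have [{}dg Dg] := dg i.
split; first by move=> x; exact: derivableM.
rewrite (_ : 'D__ _ = fun x => f x * 'D_(delta_mx 0 i) g x
                               + g x * 'D_(delta_mx 0 i) f x).
  by apply: CkD; apply: IH => //; exact: CkS.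
by apply/funext => x; exact: deriveM.
Qed.

Lemma Ck_coord k (i : 'I_m) : Ck k (fun x : 'rV[R]_m => x 0 i : R^o).
Proof.
case: k => [|k]; (split; first by move=> x; apply: (@coord_continuous R 1 m 0 i)) => // j.
have idD (x : 'rV[R]_m) := @derivable_id _ 'rV[R]_m x (delta_mx 0 j).
split=> [x|]; first exact: (derivable_mxP _ _ _).1 (idD x) 0 i.
rewrite (_ : 'D__ _ = fun _ : 'rV[R]_m => (j == i)%:R : R^o).
  exact: Ck_cst.
apply/funext => x; have := derive_mx (idD x).
rewrite derive_id => /matrixP/(_ 0 i); rewrite !mxE eqxx /= => <-.
by rewrite eq_sym.
Qed.

(** Directional derivatives are one-variable derivatives along a line, which
    reduces the chain rule below to the one-variable chain rule. *)
Lemma is_derive_lineP g (x v : 'rV[R]_m) (b : R) :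
  is_derive x v g b <-> is_derive (0 : R) (1 : R) (fun h : R => g (h *: v + x)) b.
Proof.
have E : 'D_1 (fun h : R => g (h *: v + x)) 0 = 'D_v g x.
  rewrite /derive; set g1 := fun h => h^-1 *: _; set g2 := fun h => h^-1 *: _.
  suff -> : g1 = g2 by [].
  by apply/funext => h; rewrite /g1 /g2 /= addr0 scale0r add0r [_%:A]mulr1.
split=> -[dg <-]; apply: DeriveDef => //.
  exact: (derivable1P g x v).1.
exact: (derivable1P g x v).2.
Qed.

Lemma is_derive_comp_dir (f : R -> R) g (x v : 'rV[R]_m) (a b : R) :
  is_derive (g x) (1 : R) f a -> is_derive x v g b ->
  is_derive x v (f \o g : _ -> R^o) (a * b).
Proof.
move=> df /is_derive_lineP dg; apply/is_derive_lineP.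
apply: (is_derive1_comp (f := f) (g := fun h => g (h *: v + x))) => //.
by rewrite scale0r add0r.
Qed.

(** The derivatives of cos f and sin f are products of sin f or cos f with a
    derivative of f, so the two functions must be handled together. *)
Lemma Ck_cos_sin k f : Ck k f ->
  Ck k (fun x => cos (f x) : R^o) /\ Ck k (fun x => sin (f x) : R^o).
Proof.
elim: k f => [|k IH] f Cf; have [cf df] := Cf.
  split; split=> //; move=> x; apply: continuous_comp; try exact: cf.
    exact: continuous_cos.
  exact: continuous_sin.
have [Ccos Csin] := IH _ (CkS Cf).
split; (split; first by (move=> x; apply: continuous_comp; [exact: cf|];
   by [exact: continuous_cos|exact: continuous_sin])) => i; have [{}df Df] := df i.
- have D x := is_derive_comp_dir (is_derive_cos (f x)) (derivableP (df x)).
  split=> [x|]; first by case: (D x).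
  rewrite (_ : 'D__ _ = fun x => (-1 * sin (f x)) * 'D_(delta_mx 0 i) f x).
    by apply: CkM => //; apply: CkM => //; exact: Ck_cst.
  by apply/funext => x; case: (D x) => _ ->; rewrite mulN1r.
- have D x := is_derive_comp_dir (is_derive_sin (f x)) (derivableP (df x)).
  split=> [x|]; first by case: (D x).
  rewrite (_ : 'D__ _ = fun x => cos (f x) * 'D_(delta_mx 0 i) f x).
    exact: CkM.
  by apply/funext => x; case: (D x) => _ ->.
Qed.

End Ck_calculus.

Lemma cos_sample_smooth (R : realType) :
  sample_smooth (real_plots R) (real_plots R) (@cos R).
Proof.
move=> n p [sp mp]; split=> [w k|t].
  by have [] := Ck_cos_sin (sp w k).
apply/(measurable_realP (fun w => cos (p (t, w)))).
apply: measurableT_comp.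
  exact: measurable_cos.
exact: (measurable_realP (fun w => p (t, w))).1 (mp t).
Qed.

(** Each differentiation shifts the argument by pi / 2, so one formula covers the
    four cases of k modulo 4 and bounds all derivatives by 1. *)
Lemma derive1n_cos (R : realType) (k : nat) :
  derive1n k (@cos R) = fun x => cos (x + (pi / 2) *+ k).
Proof.
elim: k => [|k IH]; first by apply/funext => x; rewrite addr0.
rewrite derive1nS IH; apply/funext => x.
rewrite [_ *+ k.+1]mulrSr addrA cosDpihalf derive1E.
have D := is_derive_shift x 1 ((pi / 2) *+ k).
have [_] := is_derive1_comp (g := shift _) (is_derive_cos _) D.
by rewrite mulr1.
Qed.

(** The difference quotients at 0 are at most - c on the right and at least c on
    the left, so that they have no common limit. *)
Lemma corner_not_derivable (R : realType) (f : R -> R) (c d : R) :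
  0 < c -> 0 < d -> (forall h, h != 0 -> `|h| <= d -> f h <= f 0 - c * `|h|) ->
  ~ derivable f 0 1.
Proof.
move=> c0 d0 fc df.
pose q h := h^-1 *: (f (h *: 1 + 0) - f 0).
have qE h : q h = h^-1 * (f h - f 0) by rewrite /q addr0 [_%:A]mulr1.
have qcvg : q h @[h --> 0^'] --> 'D_1 f 0 := df.
have qr := cvg_dnbhs_at_right qcvg; have ql := cvg_dnbhs_at_left qcvg.
have : 'D_1 f 0 <= - c.
  rewrite -(cvg_lim (@Rhausdorff R) qr); apply: limr_le; first exact: cvgP qr.
  near=> h.
  have h0 : 0 < h by near: h; exact: nbhs_right_gt.
  have hd : h <= d by near: h; exact: nbhs_right_le.
  rewrite qE ler_pdivrMl//.
  have := fc h (lt0r_neq0 h0); rewrite gtr0_norm// => /(_ hd).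
  by lra.
have : c <= 'D_1 f 0.
  rewrite -(cvg_lim (@Rhausdorff R) ql); apply: limr_ge; first exact: cvgP ql.
  near=> h.
  have h0 : h < 0 by near: h; exact: nbhs_left_lt.
  have hd : - d <= h by near: h; apply: nbhs_left_ge; rewrite oppr_lt0.
  rewrite qE ler_ndivlMl//.
  have := fc h (ltr0_neq0 h0); rewrite ltr0_norm// lerNl => /(_ hd).
  by lra.
by lra.
Unshelve. all: by end_near.
Qed.

(** * Laws of real random variables as points of the space of measures *)

Lemma real_Omega_plot (R : realType) (X : Omega R -> R) :
  Omega_plot (real_plots R) X <-> measurable_fun [set: Omega R] X.
Proof.
split=> [[_ mX]|mX]; first by apply/measurable_realP; exact: mX 0.
split=> [w k|t] /=; first exact: Ck_cst.
exact: (measurable_realP X).2.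
Qed.

(** This makes Borel functions measurable for the sigma-algebra induced by the
    plots. *)
Lemma induced_real_measurable (R : realType) (A : set R) : measurable A ->
  measurable (A : set (induced_space (real_plots R))).
Proof.
move=> mA; rewrite /measurable /= => X /real_Omega_plot mX.
by rewrite -[X in measurable X]setTI; exact: mX.
Qed.

Lemma measurable_plot (R : realType) (T : pointedType) (p : plot_family R T)
    (X : Omega R -> induced_space p) :
  Omega_plot p X -> measurable_fun [set: Omega R] X.
Proof. by move=> pX _ A mA; rewrite setTI; exact: mA. Qed.

Section law.
Variables (R : realType) (U : probability (Omega R) R) (T : pointedType).
Variables (p : plot_family R T) (X : Omega R -> T) (pX : Omega_plot p X).

Definition law_RV : {mfun Omega R >-> induced_space p} :=
  mfun_Sub (mem_set (measurable_plot pX)).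

Definition law : measures p :=
  exist _ (distribution U law_RV : probability (induced_space p) R)
    (ex_intro _ X (ex_intro _ U (conj pX (fun _ _ => erefl)))).

End law.

Lemma bounded_integrable (R : realType) d (T : measurableType d)
    (P : probability T R) (f : T -> R) (M : R) :
  measurable_fun [set: T] f -> (forall x, `|f x| <= M) ->
  P.-integrable [set: T] (EFin \o f).
Proof.
move=> mf fM; apply: measurable_bounded_integrable => //.
  by rewrite (le_lt_trans (probability_le1 _ _)) ?ltry.
exists M; split; first exact: num_real.
by move=> y My x _; rewrite /= (le_trans (fM _)) // ltW.
Qed.

Lemma integral_law (R : realType) (U : probability (Omega R) R)
    (X : Omega R -> R) (pX : Omega_plot (real_plots R) X) (f : R -> R) (M : R) :
  measurable_fun [set: R] f -> (forall x, `|f x| <= M) ->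
  \int[measure_of (law U pX)]_x f x = \int[U]_w f (X w).
Proof.
move=> mf fM; rewrite /Rintegral; congr fine.
rewrite (@integral_distribution _ _ _ _ _ _ (law_RV pX) (EFin \o f)) //.
- apply/measurable_EFinP => _ A mA; rewrite setTI.
  by apply: induced_real_measurable; rewrite -[X in measurable X]setTI; exact: mf.
- apply: (bounded_integrable U (f := f \o X) (M := M)) => [|w]; last exact: fM.
  by apply: measurableT_comp => //; exact/real_Omega_plot.
Qed.

Lemma cos_le0 (R : realType) (x : R) : pi / 2 <= x <= pi / 2 + pi -> cos x <= 0.
Proof.
move=> /andP[px xp]; rewrite -[x](subrK pi) cosDpi oppr_le0.
by apply: cos_ge0_pihalf; apply/andP; split; lra.
Qed.

Lemma cos_normr (R : realType) (x : R) : cos `|x| = cos x.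
Proof. by case: (ger0P x) => // _; rewrite cosN. Qed.

(** * The law of t / w for a uniform w *)

Section reciprocal.
Variables (R : realType).

Definition scaled_reciprocal (n : nat) (t : R) (w : Omega R) : R :=
  t * (w n)%:num^-1.

Lemma scaled_reciprocal_plot (n : nat) :
  real_plots R 1 (fun u => scaled_reciprocal n (u.1 0 0) u.2).
Proof.
split=> [w k|t] /=; first by apply: CkM; [exact: Ck_coord | exact: Ck_cst].
apply/(measurable_realP (scaled_reciprocal n (t 0 0))).
by apply: measurable_funM => //; exact: measurable_invcoord.
Qed.

Lemma scaled_reciprocal_Omega_plot (n : nat) (t : R) :
  Omega_plot (real_plots R) (scaled_reciprocal n t).
Proof.
apply/real_Omega_plot.
by apply: measurable_funM => //; exact: measurable_invcoord.
Qed.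

Variable U : probability (Omega R) R.

Definition reciprocal_law (t : R) : measures (real_plots R) :=
  law U (scaled_reciprocal_Omega_plot 0 t).

(** The second argument of [Theta_inv] occupies the odd coordinates: coordinate 1
    of the plot becomes coordinate 0 of the randomness integrated out, whence the
    two different indices. *)
Lemma reciprocal_law_plot :
  measures_plots U (real_plots R) 1 (fun u => reciprocal_law (u.1 0 0)).
Proof. by eexists; first exact: (scaled_reciprocal_plot 1). Qed.

Hypothesis hU : uniform_measure U.

Lemma uniform_coord_itv (a b : R) : 0 <= a -> a <= b -> b <= 1 ->
  U [set w | a <= (w 0%N)%:num <= b] = (b - a)%:E.
Proof.
move=> a0 ab b1.
have -> : [set w : Omega R | a <= (w 0%N)%:num <= b] =
    [set w | forall i, (i < 1)%N -> `[a, b]%classic (w i)%:num].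
  apply/seteqP; split => w /=; last by move=> /(_ 0%N isT); rewrite in_itv.
  by move=> h [|//] _; rewrite in_itv.
rewrite (hU 1 (A := fun=> `[a, b]%classic)) // big_ord1 /uniform_prob.
rewrite (eq_integral (fun=> 1%:E)); last first.
  move=> x; rewrite inE /= in_itv /= => /andP[ax xb].
  by rewrite /uniform_pdf (le_trans a0 ax) (le_trans xb b1) subr0 invr1.
rewrite integral_cst //= mul1e lebesgue_measure_itv /= lte_fin.
case: ltP => // ba; have -> : a = b by apply/le_anti; rewrite ab ba.
by rewrite subrr.
Qed.

(** The real part of the characteristic function of 1 / w. *)
Definition reciprocal_char (t : R) : R := \int[U]_w cos (scaled_reciprocal 0 t w).

Lemma reciprocal_char0 : reciprocal_char 0 = 1.
Proof.
rewrite /reciprocal_char; under eq_Rintegral do rewrite /scaled_reciprocal mul0r cos0.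
by rewrite Rintegral_cst // mul1r -[RHS]/(fine 1%:E) -(probability_setT U).
Qed.

(** Compare the cosine with 1 minus the indicator of the event that t / w has
    absolute value in [pi / 2, pi], where it is at most 0. This event says that w
    lies in [|t| / pi, 2 |t| / pi], and the bound on |t| keeps that interval
    within [0, 1], so that its probability is its length. *)
Lemma reciprocal_char_le (t : R) : t != 0 -> `|t| <= pi / 2 ->
  reciprocal_char t <= reciprocal_char 0 - pi^-1 * `|t|.
Proof.
move=> t0 tpi; rewrite reciprocal_char0.
have p0 := pi_gt0 R.
have a0 : 0 < pi^-1 * `|t| by rewrite mulr_gt0 ?invr_gt0 ?normr_gt0.
set E := [set w : Omega R | pi^-1 * `|t| <= (w 0%N)%:num <= 2 * (pi^-1 * `|t|)].
have mE : measurable E.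
  rewrite -[X in measurable X]setTI.
  have -> : E = (fun w : Omega R => (w 0%N)%:num) @^-1`
      `[pi^-1 * `|t|, 2 * (pi^-1 * `|t|)]%classic.
    by apply/seteqP; split=> w /=; rewrite in_itv.
  exact: measurable_coord.
have UE : U E = (pi^-1 * `|t|)%:E.
  rewrite uniform_coord_itv; [congr EFin; lra | lra | lra |].
  rewrite mulrCA mulrC ler_pdivrMr //; lra.
have le w : cos (scaled_reciprocal 0 t w) <= 1 - \1_E w.
  rewrite indicE; case: (boolP (w \in E)) => wE; last by rewrite subr0 cos_le1.
  rewrite subrr.
  move: wE; rewrite inE /E /= => /andP[aw wa].
  have w0 : 0 < (w 0%N)%:num := lt_le_trans a0 aw.
  rewrite -cos_normr normrM normfV (gtr0_norm w0); apply: cos_le0.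
  rewrite ler_pdivlMr // ler_pdivrMr //.
  have := ler_wpM2l (ltW p0) aw; have := ler_wpM2l (ltW p0) wa.
  have : 0 < pi * (w 0%N)%:num by rewrite mulr_gt0.
  rewrite [pi * (2 * _)]mulrCA mulVKf ?gt_eqF //; lra.
have mX : measurable_fun [set: Omega R] (fun w => cos (scaled_reciprocal 0 t w)).
  apply: measurableT_comp; first exact: measurable_cos.
  exact/real_Omega_plot/scaled_reciprocal_Omega_plot.
have iX := bounded_integrable U mX (fun w => cos_max _).
have i1 : U.-integrable [set: Omega R] (EFin \o cst (1 : R)).
  by apply: (bounded_integrable U (f := cst 1) (M := 1)) => // w; rewrite normr1.
have iE : U.-integrable [set: Omega R] (EFin \o \1_E).
  apply: (bounded_integrable U (f := \1_E) (M := 1)) => [|w].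
    exact: measurable_indic.
  by rewrite indicE; case: (_ \in _); rewrite ?normr1 ?normr0.
have -> : 1 - pi^-1 * `|t| = \int[U]_w (cst 1 w - \1_E w).
  rewrite RintegralB // Rintegral_cst // mul1r.
  rewrite (_ : fine (U setT) = 1) ?(congr1 fine (probability_setT U)) //.
  rewrite /Rintegral integral_indic // setIT; congr (_ - _).
  exact: esym (congr1 fine UE).
apply: le_Rintegral => //.
exact: (integrableB measurableT i1 iE).
Qed.

End reciprocal.

Lemma integral_cos_reciprocal_law (R : realType) (U : probability (Omega R) R) (t : R) :
  \int[measure_of (reciprocal_law U t)]_x cos (x : R) = reciprocal_char U t.
Proof. exact: (integral_law _ _ (@measurable_cos R) (@cos_max R)). Qed.

(** A plot has first partial derivatives, and the one at t = 0 would be a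
    derivative of [reciprocal_char] at its corner. *)
Lemma reciprocal_char_not_plot (R : realType) (U : probability (Omega R) R)
    (hU : uniform_measure U) :
  ~ real_plots R 1 (fun u => reciprocal_char U (u.1 0 0)).
Proof.
move=> [/(_ point 1%N)/= [_ /(_ 0)[/(_ 0) dphi _]] _].
have p0 := pi_gt0 R.
apply: (@corner_not_derivable R (reciprocal_char U) pi^-1 (pi / 2)).
- by rewrite invr_gt0.
- by rewrite divr_gt0.
- by move=> h h0 hpi; exact: reciprocal_char_le.
pose phi (x : 'rV[R]_1) : R^o := reciprocal_char U (x 0 0).
have -> : reciprocal_char U = fun h => phi (h *: delta_mx 0 0 + 0).
  by apply/funext => h; rewrite /phi !mxE eqxx mulr1 addr0.
exact: (derivable1P phi 0 (delta_mx 0 0)).1 dphi.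
Qed.

Theorem theorem6p15 (R : realType) (U : probability (Omega R) R)
    (hU : uniform_measure U) :
  [/\ ~ sample_smooth (measures_plots U (real_plots R)) (real_plots R)
        (fun mu : measures (real_plots R) => \int[measure_of mu]_x cos (x : R)),
      sample_smooth (real_plots R) (real_plots R) (@cos R),
      (exists M : R, forall x : R, `|cos x| <= M),
      (forall k : nat, (forall x : R, derivable (derive1n k (@cos R)) x 1) /\
         exists M : R, forall x : R, `|derive1n k (@cos R) x| <= M) &
      ~ sample_smooth
          (prod_plots (Cb_plots R) (measures_plots U (real_plots R)))
          (real_plots R)
          (fun z : Cb R * measures (real_plots R) =>
             \int[measure_of z.2]_x sval (sval z.1) x)].
Proof.
have mP := reciprocal_law_plot U.
have charE : (fun u : Omega_ R 1 =>
      \int[measure_of (reciprocal_law U (u.1 0 0))]_x cos (x : R)) =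
    fun u => reciprocal_char U (u.1 0 0).
  by apply/funext => u; exact: integral_cos_reciprocal_law.
split.
- move=> /(_ 1%N _ mP); rewrite /comp charE.
  exact: reciprocal_char_not_plot.
- exact: cos_sample_smooth.
- by exists 1; exact: cos_max.
- move=> k; rewrite derive1n_cos; split; last by exists 1 => x; exact: cos_max.
  move=> x; have [//] := is_derive1_comp (g := shift _) (is_derive_cos _)
    (is_derive_shift x 1 ((pi / 2) *+ k)).
- pose c : Cb R := exist _ (exist _ _ (@cos_sample_smooth R))
    (ex_intro _ 1 (@cos_max R)).
  move=> /(_ 1%N (fun u => (c, reciprocal_law U (u.1 0 0)))) h.
  apply: (reciprocal_char_not_plot hU); rewrite -charE; apply: h.
  split=> //= m h q _ pq; exact: cos_sample_smooth.
Qed.
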